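(* Let $(X,T)$ be a topological space and $({}^*X,{}^sT)$ its nonstandard compactification. Let $\tau$ be the usual topology on $\mathbb R$ and $({}^*\mathbb R,{}^s\tau)$ the nonstandard compactification of $(\mathbb R,\tau)$. Then for any continuous $f:(X,T)\to(\mathbb R,\tau)$ both mappings $${}^*f:({}^*X,{}^sT)\to({}^*\mathbb R,{}^s\tau)\qquad\text{and}\qquad {}^\circ f=\mathrm{st}\circ{}^*f:(\widetilde X_f,{}^sT)\to(\mathbb R,\tau)$$ are continuous, where $\widetilde X_f=\{\alpha\in{}^*X:{}^*f(\alpha)\text{ is a finite number in }{}^*\mathbb R\}$. Also, ${}^\circ f$ is the unique real-valued continuous extension of $f$ to $\widetilde X_f$.
   Context: Nonstandard setting. Let $S\supseteq X\cup\mathbb R$ be a set of individuals, with superstructure $V(S)=\bigcup_{k\ge 0}V_k(S)$, $V_0(S)=S$, $V_{k+1}(S)=V_k(S)\cup\mathcal P(V_k(S))$. A $\kappa$-saturated nonstandard model of $S$ is a superstructure $V({}^*S)$ with a map $A\mapsto {}^*A$ from $V(S)$ into $V({}^*S)$ satisfying: (Extension) ${}^*s=s$ for all $s\in S$; (Transfer) a bounded quantifier formula $\Phi(A_1,\dots,A_n)$ with constants in $V(S)$ is true iff $\Phi({}^*A_1,\dots,{}^*A_n)$ is true in $V({}^*S)$; (Saturation) every family of at most $\kappa$ internal sets with the finite intersection property has nonempty intersection. An entity of $V({}^*S)$ is internal if it is an element of ${}^*A$ for some $A\in V(S)$. Throughout, a $\kappa$-saturated model with $\kappa$ infinite and $\kappa>\max(\operatorname{card}T,\operatorname{card}\tau)$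 is fixed; $X\subseteq {}^*X$, $\mathbb R\subseteq{}^*\mathbb R$. For a topological space $(Y,U)$ (here $Y=X$ or $\mathbb R$), the standard topology ${}^sU$ on ${}^*Y$ has base $\{{}^*G:G\in U\}$, and $({}^*Y,{}^sU)$ is called the nonstandard compactification of $(Y,U)$. Subsets of ${}^*X$ such as $\widetilde X_f$ carry the subspace topology. A number $\xi\in{}^*\mathbb R$ is finite if $|\xi|<n$ for some $n\in\mathbb N$, and $\mathrm{st}(\xi)$ is then the unique real number $x$ with $\xi\approx x$, i.e. $|\xi-x|<1/n$ for all $n\in\mathbb N$. *)

(* Defs.v *)
From HB Require Import structures.
From mathcomp Require Import all_boot all_order all_algebra.
From mathcomp Require Import all_classical all_reals topology normedtype.
From Stdlib Require Eqdep_dec PeanoNat.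

Set Implicit Arguments.
Unset Strict Implicit.
Unset Printing Implicit Defensive.

Import Order.TTheory GRing.Theory Num.Theory.
Import numFieldNormedType.Exports.
Local Open Scope classical_set_scope.
Local Open Scope card_scope.
Local Open Scope ring_scope.

(** * The superstructure V(S) over a set S of individuals

    V_(k+1)(S) = V_k(S) \cup P(V_k(S)) is built as the disjoint union of V_k(S)
    and of P(V_k(S)) \ V_k(S).  A subset of V_k(S) is "fresh" when it is not
    already an element of V_k(S): every subset of V_0(S) = S is fresh, and a
    subset of V_(k+1)(S) is fresh iff it is not included in V_k(S). *)

Record stage := Stage { stage_sort : Type; fresh : set (set stage_sort) }.

Fixpoint stageV (S : Type) (k : nat) : stage :=
  match k with
  | 0 => @Stage S setT
  | k'.+1 => let V := stageV S k' in
      @Stage (stage_sort V + {A : set (stage_sort V) | fresh A})%type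
             [set B | exists A, B (inr A)]
  end.

Arguments stageV : simpl never.

Definition stageT (S : Type) (k : nat) : Type := stage_sort (stageV S k).

Variant superstr (S : Type) : Type :=
  | Ind of S
  | Coll (k : nat) of {A : set (stageT S k) | fresh A}.

Fixpoint incl (S : Type) (k : nat) : stageT S k -> superstr S :=
  match k return stageT S k -> superstr S with
  | 0 => fun s => Ind s
  | k'.+1 => fun x => match x with
                      | inl y => incl y
                      | inr A => Coll A
                      end
  end.

Definition mem (S : Type) (x y : superstr S) : Prop :=
  match y with
  | Ind _ => False
  | Coll k A => exists2 z : stageT S k, sval A z & incl z = x
  end.

Definition isset (S : Type) (x : superstr S) : Prop :=
  if x is Coll _ _ then True else False.

Definition level (S : Type) (k : nat) : set (superstr S) :=
  range (@incl S k).
Arguments level : clear implicits.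

Section Superstructure.
Variable S : Type.
Implicit Types (x : superstr S) (P : set (superstr S)).

Definition rank x : nat := if x is Coll k _ then k.+1 else 0%N.

Lemma rank_incl k (z : stageT S k) : (rank (incl z) <= k)%N.
Proof. by elim: k z => [//|k IH] [z|A] //=; apply: leqW. Qed.

Lemma Coll_inj k : injective (@Coll S k).
Proof.
move=> A B [].
exact: (Eqdep_dec.inj_pair2_eq_dec _ PeanoNat.Nat.eq_dec _ _ _ _).
Qed.

Lemma incl_inj k : injective (@incl S k).
Proof.
elim: k => [|k IH]; first by move=> x y /= [].
move=> [x|A] [y|B] /= E.
- by rewrite (IH _ _ E).
- by have := rank_incl x; rewrite E ltnn.
- by have := rank_incl y; rewrite -E ltnn.
- by rewrite (Coll_inj E).
Qed.

Lemma level0 x : level S 0 x <-> exists s, x = Ind s.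
Proof. by split=> [[s _ <-]|[s ->]]; exists s. Qed.

Lemma levelS k x : level S k.+1 x <->
  level S k x \/ (isset x /\ forall y, mem y x -> level S k y).
Proof.
split=> [[[y|A] _ <-]|[[y _ <-]|[]]].
- by left; exists y.
- by right; split=> // _ [z _ <-]; exists z.
- by exists (inl y).
- case: x => // j A _ H.
  have [jk|kj] := leqP j k.
    move: (j) A jk {H}; elim: (k) => [|k' IH] i A.
      by rewrite leqn0 => /eqP i0; move: A; rewrite i0 => A; exists (inr A).
    rewrite leq_eqVlt => /predU1P[ik|ik].
      by move: A; rewrite ik => A; exists (inr A).
    by have [a _ <-] := IH i A ik; exists (inl a).
  exfalso; case: j A H kj => // j [A [a Aa]] H /= kj.
  have [|z _ zE] := H (Coll a); first by exists (inr a).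
  by have := rank_incl z; rewrite zE /= leqNgt kj.
Qed.

Lemma level_le j k : (j <= k)%N -> level S j `<=` level S k.
Proof.
move=> /subnK <-; elim: (k - j)%N => // i IH x /IH [y _ <-].
by exists (inl y).
Qed.

Lemma level_ex x : exists k, level S k x.
Proof.
case: x => [s|k A]; first by exists 0%N, s.
by exists k.+1, (inr A).
Qed.

Lemma mem_Ind x s : ~ mem x (Ind s). Proof. by []. Qed.

(** The entity whose elements are those of [A], a subset of V_k(S). *)
Fixpoint collect (k : nat) : set (stageT S k) -> superstr S :=
  match k return set (stageT S k) -> superstr S with
  | 0 => fun A => @Coll S 0 (exist _ A I)
  | k'.+1 => fun A => match pselect (@fresh (stageV S k'.+1) A) with
                      | left h => @Coll S k'.+1 (exist _ A h)
                      | right _ => collect (A \o inl)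
                      end
  end.

Lemma collectS k (A : set (stageT S k.+1)) :
  collect A = match pselect (@fresh (stageV S k.+1) A) with
              | left h => @Coll S k.+1 (exist _ A h)
              | right _ => @collect k (A \o inl)
              end.
Proof. by []. Qed.

Lemma isset_collect k (A : set (stageT S k)) : isset (collect A).
Proof.
by elim: k A => [//|k IH] A; rewrite collectS; case: pselect => // _; apply: IH.
Qed.

Lemma mem_collect k (A : set (stageT S k)) x :
  mem x (collect A) <-> exists2 z, A z & incl z = x.
Proof.
elim: k A x => [//|k IH] A x; rewrite collectS; case: pselect => [h|h]; first by [].
split=> [/IH[z Az <-]|[[z|B] Az <-]]; first by exists (inl z).
- by apply/IH; exists z.
- by case: h; exists B.
Qed.

Lemma mem_ext x y : isset x -> isset y ->
  (forall z, mem z x <-> mem z y) -> x = y.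
Proof.
have tot j k : (j <= k)%N -> forall (A : {A : set (stageT S j) | fresh A})
    (B : {B : set (stageT S k) | fresh B}),
    (forall z, mem z (Coll A) <-> mem z (Coll B)) -> Coll A = Coll B.
  move=> jk A B AB.
  have [E|ltjk] : j = k \/ (j < k)%N.
  + by move: jk; rewrite leq_eqVlt => /predU1P.
  + move: A B AB; case: k / E {jk} => A B AB; congr Coll.
    case: A B AB => [A hA] [B hB] AB; apply: eq_exist.
    apply/seteqP; split=> z hz.
      have /AB[z' Bz' /incl_inj <- //] : mem (incl z) (Coll (exist _ A hA)).
      by exists z.
    have /AB[z' Bz' /incl_inj <- //] : mem (incl z) (Coll (exist _ B hB)).
    by exists z.
  + exfalso; case: k B ltjk {jk} AB => // k [B [b Bb]] ltjk AB.
    have /AB[z _ zb] : mem (Coll b) (Coll (exist _ B (ex_intro _ b Bb))).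
      by exists (inr b).
    have : level S k (Coll b).
      by apply: (level_le (ltnSE ltjk)); exists z.
    move=> [w _ wb].
    have /incl_inj // : @incl S k.+1 (inl w) = @incl S k.+1 (inr b).
    exact: wb.
case: x y => [//|j A] [//|k B] _ _ AB.
have [jk|/ltnW kj] := leqP j k; first exact: tot.
by apply/esym/tot => // z; split=> /AB.
Qed.

(** The entity whose elements are those of [P]; meaningful when P is included
    in some V_k(S), see [mem_setof], and the empty set otherwise. *)
Definition setof P : superstr S :=
  match pselect (exists k, P `<=` level S k) with
  | left h => collect (@incl S (sval (cid h)) @^-1` P)
  | right _ => collect (set0 : set (stageT S 0))
  end.

Lemma isset_setof P : isset (setof P).
Proof. by rewrite /setof; case: pselect => *; apply: isset_collect. Qed.

Lemma mem_setof k P x : P `<=` level S k -> mem x (setof P) <-> P x.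
Proof.
move=> Pk; rewrite /setof; case: pselect => [h|[]]; last by exists k.
case: cid => j Pj /=; split=> [/mem_collect[z Pz <- //]|Px].
by apply/mem_collect; have [z _ zx] := Pj _ Px; exists z => //=; rewrite /= zx.
Qed.

Lemma level_setof k P : P `<=` level S k -> level S k.+1 (setof P).
Proof.
move=> Pk; apply/levelS; right; split; first exact: isset_setof.
by move=> y /(mem_setof _ Pk)/Pk.
Qed.

(** Kuratowski ordered pairs. *)
Definition pair x y : superstr S :=
  setof [set setof [set x]; setof [set x; y]].

Lemma level2 x y : exists k, level S k x /\ level S k y.
Proof.
have [j xj] := level_ex x; have [k yk] := level_ex y.
exists (maxn j k); split.
- exact: level_le (leq_maxl _ _) _ xj.
- exact: level_le (leq_maxr _ _) _ yk.
Qed.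

Lemma mem_set1 x z : mem z (setof [set x]) <-> z = x.
Proof. by have [k xk] := level_ex x; apply: (@mem_setof k) => _ ->. Qed.

Lemma mem_set2 x y z : mem z (setof [set x; y]) <-> z = x \/ z = y.
Proof.
by have [k [xk yk]] := level2 x y; apply: (@mem_setof k) => _ [] ->.
Qed.

Lemma mem_pair x y z :
  mem z (pair x y) <-> z = setof [set x] \/ z = setof [set x; y].
Proof. exact: mem_set2. Qed.

Lemma level_pair k x y :
  level S k x -> level S k y -> level S k.+2 (pair x y).
Proof.
by move=> xk yk; apply: level_setof => _ [] ->; apply: level_setof => _ //= [] ->.
Qed.

Lemma pair_inj x y x' y' : pair x y = pair x' y' -> x = x' /\ y = y'.
Proof.
move=> E.
have M z : (z = setof [set x] \/ z = setof [set x; y]) <->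
           (z = setof [set x'] \/ z = setof [set x'; y']).
  by rewrite -!mem_pair E.
have xx' : x = x'.
  have [/(_ (or_introl erefl)) H _] := M (setof [set x]).
  case: H => H.
    by have /mem_set1 : mem x (setof [set x']) by rewrite -H; apply/mem_set1.
  have : mem x' (setof [set x]) by rewrite H; apply/mem_set2; left.
  by move/mem_set1.
split=> //; rewrite -{}xx' {E x'} in M *.
have [/(_ (or_intror erefl)) H _] := M (setof [set x; y]).
have [_ /(_ (or_intror erefl)) H'] := M (setof [set x; y']).
have yx2 : mem y (setof [set x; y]) by apply/mem_set2; right.
have y'x2 : mem y' (setof [set x; y']) by apply/mem_set2; right.
have {H} : mem y (setof [set x]) \/ mem y (setof [set x; y']).
  by case: H => <-; [left|right].
have {H'} : mem y' (setof [set x]) \/ mem y' (setof [set x; y]).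
  by case: H' => <-; [left|right].
move=> [/mem_set1|/mem_set2[]] ? [/mem_set1|/mem_set2[]] ?; congruence.
Qed.

(** Value at [a] of a function given by its graph [F]. *)
Definition app (F a : superstr S) : superstr S :=
  match pselect (exists b, mem (pair a b) F) with
  | left h => sval (cid h)
  | right _ => setof set0
  end.

Lemma app_mem (F a b : superstr S) :
  mem (pair a b) F -> mem (pair a (app F a)) F.
Proof.
move=> h; rewrite /app; case: pselect => [h'|[]]; last by exists b.
by case: cid.
Qed.

(** The set {i y | y \in A}, and the graph of [f] when y : Y is encoded as
    i y and z : Z as j z. *)
Definition image_ent (Y : Type) (i : Y -> superstr S) (A : set Y) :=
  setof (i @` A).

Definition rel_ent (Y Z : Type) (i : Y -> superstr S) (j : Z -> superstr S)
    (r : Y -> Z -> Prop) :=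
  setof [set p | exists y z, r y z /\ p = pair (i y) (j z)].

Definition graph_ent (Y Z : Type) (i : Y -> superstr S) (j : Z -> superstr S)
    (f : Y -> Z) :=
  rel_ent i j (fun y z => z = f y).

End Superstructure.

(** * Bounded quantifier formulas

    Variables are natural numbers.  The free variables of a formula
    Phi(A_1, ..., A_n) are the places of the constants A_1, ..., A_n, which are
    provided by the valuation; [BAll m n phi] is (forall x_m \in x_n) phi. *)

Inductive bqf : Type :=
  | BMem of nat & nat
  | BEq of nat & nat
  | BNot of bqf
  | BAnd of bqf & bqf
  | BOr of bqf & bqf
  | BImp of bqf & bqf
  | BAll of nat & nat & bqf
  | BEx of nat & nat & bqf.

Definition update (T : Type) (v : nat -> T) (n : nat) (a : T) : nat -> T :=
  fun m => if m == n then a else v m.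

Fixpoint holds (S : Type) (v : nat -> superstr S) (phi : bqf) : Prop :=
  match phi with
  | BMem m n => mem (v m) (v n)
  | BEq m n => v m = v n
  | BNot p => ~ holds v p
  | BAnd p q => holds v p /\ holds v q
  | BOr p q => holds v p \/ holds v q
  | BImp p q => holds v p -> holds v q
  | BAll m n p => forall a, mem a (v n) -> holds (update v m a) p
  | BEx m n p => exists a, mem a (v n) /\ holds (update v m a) p
  end.

(** * Nonstandard models *)

Definition internal_in (S S' : Type) (star : superstr S -> superstr S')
  (x : superstr S') : Prop := exists A, mem x (star A).

(** The cardinal kappa is that of the type [K].  The individuals of the model
    form *S, the value of the map at the entity S, and contain S through
    [std]. *)
Record nsmodel (K S : Type) := NSModel {
  starS : Type;
  std : S -> starS;
  star : superstr S -> superstr starS;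
  star_individuals :
    star (image_ent (@Ind S) setT) = image_ent (@Ind starS) setT;
  extension : forall s, star (Ind s) = Ind (std s);
  transfer : forall (phi : bqf) (v : nat -> superstr S),
    holds v phi <-> holds (fun n => star (v n)) phi;
  saturation : forall F : set (superstr starS),
    F `<=` [set A | internal_in star A /\ isset A] ->
    F #<= [set: K] ->
    (forall D, finite_set D -> D `<=` F ->
       \bigcap_(A in D) [set x | mem x A] !=set0) ->
    \bigcap_(A in F) [set x | mem x A] !=set0
}.

Definition card_lt (T U : Type) (A : set T) (B : set U) : Prop :=
  (A #<= B) /\ ~ (B #<= A).

Section Models.
Variables (K S : Type) (M : nsmodel K S).

Lemma star_mem (x y : superstr S) :
  mem (star M x) (star M y) <-> mem x y.
Proof.
exact: iff_sym (transfer M (BMem 0 1) (fun n => if n == 0%N then x else y)).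
Qed.

Section Space.
Variables (Y : topologicalType) (i : {inj [set: Y] >-> S}).

Definition ient (y : Y) : superstr S := Ind (i y).

Lemma ient_inj : injective ient.
Proof. by move=> y z []; apply: (@injT _ _ i). Qed.

Lemma ient_level (A : set Y) : ient @` A `<=` level S 0.
Proof. by move=> _ [y _ <-]; exists (i y). Qed.

Lemma mem_ient (A : set Y) x : mem x (image_ent ient A) <-> (ient @` A) x.
Proof. exact: mem_setof (@ient_level A). Qed.

(** The set *Y, for Y seen as a subset of S through [i], and the subset *A of
    *Y for a subset A of Y. *)
Definition nscompact : Type :=
  {a : superstr (starS M) | mem a (star M (image_ent ient setT))}.

Definition star_set (A : set Y) : set nscompact :=
  [set a | mem (sval a) (star M (image_ent ient A))].

Lemma std_pt_subproof (y : Y) :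
  mem (Ind (std M (i y))) (star M (image_ent ient setT)).
Proof. by rewrite -extension star_mem; apply/mem_ient; exists y. Qed.

(** The inclusion of Y in *Y. *)
Definition std_pt (y : Y) : nscompact :=
  exist (fun a => mem a _) _ (std_pt_subproof y).

Lemma star_setT : star_set setT = setT.
Proof. by apply/seteqP; split=> // -[]. Qed.

Lemma star_setI (A B : set Y) :
  star_set (A `&` B) = star_set A `&` star_set B.
Proof.
pose v n := if n == 0%N then image_ent ient (A `&` B) else
            if n == 1%N then image_ent ient A else image_ent ient B.
have := transfer M (BAnd (BAll 3 0 (BAnd (BMem 3 1) (BMem 3 2)))
  (BAll 3 1 (BImp (BMem 3 2) (BMem 3 0)))) v.
case=> + _; rewrite /update /v /= => H.
case: H => [|HI HJ].
  split=> a.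
    by move/mem_ient => [y [Ay By] <-]; split; apply/mem_ient; exists y.
  move=> /mem_ient[y Ay <-] /mem_ient[z Bz /ient_inj zy].
  by apply/mem_ient; exists y => //; split=> //; rewrite -zy.
apply/seteqP; split=> [a /HI //|a [aA aB]].
exact: HJ aA aB.
Qed.

HB.instance Definition _ := gen_eqMixin nscompact.
HB.instance Definition _ := gen_choiceMixin nscompact.

(** The standard topology of *Y has base {*G : G open in Y}. *)
Let base (G : set Y) : set nscompact := star_set G.

Let base_cover : \bigcup_(G in [set G : set Y | open G]) base G = setT.
Proof.
apply/seteqP; split=> // a _; exists setT; first exact: openT.
by rewrite /base star_setT.
Qed.

Let base_join (G H : set Y) (a : nscompact) :
  open G -> open H -> base G a -> base H a ->
  exists L, [/\ open L, base L a & base L `<=` base G `&` base H].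
Proof.
move=> oG oH Ga Ha; exists (G `&` H); split; first exact: openI.
- by rewrite /base star_setI.
- by rewrite /base star_setI.
Qed.

HB.instance Definition _ :=
  isBaseTopological.Build nscompact base_cover base_join.

End Space.

(** ** The extension *f : *Y -> *Z of f : Y -> Z *)
Section Function.
Variables (Y Z : topologicalType).
Variables (i : {inj [set: Y] >-> S}) (j : {inj [set: Z] >-> S}).
Variable f : Y -> Z.

Let F := graph_ent (ient i) (ient j) f.

Lemma mem_graph p : mem p F <-> exists y, p = pair (ient i y) (ient j (f y)).
Proof.
have B : [set p | exists y z, z = f y /\ p = pair (ient i y) (ient j z)] `<=`
    level S 2.
  move=> _ [y [_ [-> ->]]]; apply: level_pair; first by exists (i y).
  by exists (j (f y)).
rewrite (mem_setof _ B); split=> [[y [_ [-> ->]]]|[y ->]]; first by exists y.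
by exists y, (f y).
Qed.

(* x_p = <x_a, x_b>, where the variables 10 to 14 are fresh *)
Let BPair (p a b : nat) : bqf :=
  BEx 10 p (BEx 11 p
    (BAnd (BAnd (BMem a 10) (BAll 12 10 (BEq 12 a)))
    (BAnd (BAnd (BMem a 11) (BAnd (BMem b 11)
             (BAll 13 11 (BOr (BEq 13 a) (BEq 13 b)))))
          (BAll 14 p (BOr (BEq 14 10) (BEq 14 11)))))).

Let isset_mem T (x y : superstr T) : mem x y -> isset y.
Proof. by case: y. Qed.

Let holds_pair T (v : nat -> superstr T) p a b :
  (p < 10)%N -> (a < 10)%N -> (b < 10)%N ->
  holds v (BPair p a b) <-> v p = pair (v a) (v b).
Proof.
move=> p10 a10 b10.
have ne n m : (n < 10)%N -> (10 <= m)%N -> (n == m) = false.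
  by move=> nl ml; apply/negbTE; rewrite neq_ltn (leq_trans nl ml).
rewrite /= /update /= ?ne //.
split=> [[x [xp [y [yp [[ax xa] [[ay [bY yab] pxy]]]]]]]|->].
  have Ex : x = setof [set v a].
    apply: mem_ext (isset_mem ax) (isset_setof _) _ => z.
    by rewrite mem_set1; split=> [/xa //|->].
  have Ey : y = setof [set v a; v b].
    apply: mem_ext (isset_mem ay) (isset_setof _) _ => z.
    by rewrite mem_set2; split=> [/yab //|[]->].
  apply: mem_ext (isset_mem xp) (isset_setof _) _ => z.
  by rewrite mem_pair -Ex -Ey; split=> [/pxy //|[]->].
exists (setof [set v a]); split; first by apply/mem_pair; left.
exists (setof [set v a; v b]); split; first by apply/mem_pair; right.
split; [split|split; [split; [|split]|]].
- exact/mem_set1.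
- by move=> z /mem_set1.
- by apply/mem_set2; left.
- by apply/mem_set2; right.
- by move=> z /mem_set2.
- by move=> z /mem_pair.
Qed.

Let vF n := if n == 0%N then image_ent (ient i) setT else
            if n == 1%N then image_ent (ient j) setT else F.

Lemma star_graph_total (a : nscompact i) :
  exists b, mem (pair (sval a) b) (star M F).
Proof.
have H : holds vF (BAll 3 0 (BEx 4 1 (BEx 5 2 (BPair 5 3 4)))).
  move=> _ /mem_ient[y _ <-]; exists (ient j (f y)); split.
    by apply/mem_ient; exists (f y).
  exists (pair (ient i y) (ient j (f y))); split; first by apply/mem_graph; exists y.
  exact/holds_pair.
have [b [_ [p [pF]]]] := proj1 (transfer M _ vF) H _ (svalP a).
by move/holds_pair => /(_ erefl erefl erefl) E; exists b; move: pF; rewrite [p]E.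
Qed.

Lemma star_graph_cod x b : mem (pair x b) (star M F) ->
  mem b (star M (image_ent (ient j) setT)).
Proof.
move=> xb.
have H : holds vF (BAll 5 2 (BEx 3 0 (BEx 4 1 (BPair 5 3 4)))).
  move=> _ /mem_graph[y ->]; exists (ient i y); split.
    by apply/mem_ient; exists y.
  exists (ient j (f y)); split; first by apply/mem_ient; exists (f y).
  exact/holds_pair.
have [a [_ [b' [b'Z]]]] := proj1 (transfer M _ vF) H _ xb.
move/holds_pair => /(_ erefl erefl erefl) /pair_inj[_ E].
by move: b'Z; rewrite -[b']E.
Qed.

Lemma star_fun_subproof (a : nscompact i) :
  mem (app (star M F) (sval a)) (star M (image_ent (ient j) setT)).
Proof.
by have [b /app_mem] := star_graph_total a; apply: star_graph_cod.
Qed.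

Definition star_fun (a : nscompact i) : nscompact j :=
  exist (fun b => mem b _) _ (star_fun_subproof a).

End Function.
Arguments star_fun {Y Z} i j f a.

(** ** Finite numbers and standard parts

    The subtraction, absolute value and order of *R are the values of the map
    at those of R; binary operations are functions on the set of pairs. *)
Section Reals.
Variables (R : realType) (iR : {inj [set: R] >-> S}).

Definition hyper_sub (a b : superstr (starS M)) : superstr (starS M) :=
  app (star M (graph_ent (fun p : R * R => pair (ient iR p.1) (ient iR p.2))
                         (ient iR) (fun p => p.1 - p.2)))
      (pair a b).

Definition hyper_abs (a : superstr (starS M)) : superstr (starS M) :=
  app (star M (graph_ent (ient iR) (ient iR) (fun x : R => `|x|))) a.

Definition hyper_lt (a b : superstr (starS M)) : Prop :=
  mem (pair a b) (star M (rel_ent (ient iR) (ient iR) (fun x y : R => x < y))).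

Definition finite_number (xi : nscompact iR) : Prop :=
  exists n : nat, hyper_lt (hyper_abs (sval xi)) (sval (std_pt iR n%:R)).

Definition approx (xi : nscompact iR) (x : R) : Prop :=
  forall n : nat, (0 < n)%N ->
    hyper_lt (hyper_abs (hyper_sub (sval xi) (sval (std_pt iR x))))
             (sval (std_pt iR n%:R^-1)).

(* by [get], st xi is the x such that approx xi x, if there is one *)
Definition st (xi : nscompact iR) : R := get (approx xi).

End Reals.

(** The domain of the standard part of *f, and the map st o *f, which is
    relevant on this domain only. *)
Section StandardPart.
Variables (X : topologicalType) (R : realType).
Variables (iX : {inj [set: X] >-> S}) (iR : {inj [set: R] >-> S}) (f : X -> R).

Definition finite_dom : set (nscompact iX) :=
  [set a | finite_number (star_fun iX iR f a)].

Definition st_fun (a : nscompact iX) : R := st (star_fun iX iR f a).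

End StandardPart.

End Models.

Arguments nscompact {K S} M {Y} i.
Arguments star_set {K S} M {Y} i A.
Arguments std_pt {K S} M {Y} i y.
Arguments star_fun {K S} M {Y Z} i j f a.
Arguments finite_dom {K S} M {X R} iX iR f.
Arguments st_fun {K S} M {X R} iX iR f a.

Lemma nscompact_openE (K S : Type) (M : nsmodel K S) (Y : topologicalType)
    (i : {inj [set: Y] >-> S}) (W : set (nscompact M i)) :
  open W <-> exists2 D : set (set Y), D `<=` [set G | open G] &
    \bigcup_(G in D) star_set M i G = W.
Proof. by split=> -[D oD <-]; exists D. Qed.

(* Main.v *)
(** Everything about [*R] needed here reduces to the sets [*A].  By transfer,
    [*f(a)] lies in [*A] iff [a] lies in [*(f^-1 A)]; applied to subtraction and
    absolute value this turns "xi is infinitely close to x" into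
    "xi is in [*(ball x (1/n))] for all n", and finiteness into
    "xi is in [*(ball 0 n)] for some n".  Since [A |-> *A] is a Boolean
    morphism, a finite xi has the standard part
    sup {x | xi is in [*(x, +oo)]}.  Continuity is then read off the base
    [*G], and uniqueness follows from the density of X in [*X]. *)
Require Import Defs.
From mathcomp Require Import all_boot all_order all_algebra.
From mathcomp Require Import all_classical all_reals topology normedtype.
From mathcomp Require Import lra.
Import Defs. (* MathComp's [mem] would otherwise hide [Defs.mem] *)

Set Implicit Arguments.
Unset Strict Implicit.
Unset Printing Implicit Defensive.

Import Order.TTheory GRing.Theory Num.Theory.
Import numFieldNormedType.Exports.
Local Open Scope classical_set_scope.
Local Open Scope ring_scope.

(** * Formulas for ordered pairs *)

(* x_p = <x_a, x_b>; the variables 10 to 14 are used as bound variables. *)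
Definition pair_bqf (p a b : nat) : bqf :=
  BEx 10 p (BEx 11 p
    (BAnd (BAnd (BMem a 10) (BAll 12 10 (BEq 12 a)))
    (BAnd (BAnd (BMem a 11) (BAnd (BMem b 11)
             (BAll 13 11 (BOr (BEq 13 a) (BEq 13 b)))))
          (BAll 14 p (BOr (BEq 14 10) (BEq 14 11)))))).

Lemma isset_mem (T : Type) (x y : superstr T) : mem x y -> isset y.
Proof. by case: y. Qed.

(** Extensionality forces the two witnesses, taken among the elements of [v p], to be {a} and {a,
    b}. The bounds by 10 prevent capture by the bound variables. *)
Lemma holds_pair (T : Type) (v : nat -> superstr T) (p a b : nat) :
  (p < 10)%N -> (a < 10)%N -> (b < 10)%N ->
  holds v (pair_bqf p a b) <-> v p = pair (v a) (v b).
Proof.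
move=> p10 a10 b10.
have ne n m : (n < 10)%N -> (10 <= m)%N -> (n == m) = false.
  by move=> nl ml; apply/negbTE; rewrite neq_ltn (leq_trans nl ml).
rewrite /= /update /= ?ne //; split.
  move=> [x [xp [y [yp [[ax xa] [[ay [bY yab] pxy]]]]]]].
  have Ex : x = setof [set v a].
    apply: mem_ext (isset_mem ax) (isset_setof _) _ => z.
    by split=> [/xa ->|/mem_set1 ->//]; apply/mem_set1.
  have Ey : y = setof [set v a; v b].
    apply: mem_ext (isset_mem ay) (isset_setof _) _ => z.
    by split=> [/yab ?|/mem_set2[]->//]; apply/mem_set2.
  apply: mem_ext (isset_mem xp) (isset_setof _) _ => z.
  split=> [/pxy zxy|/mem_pair]; last by rewrite -Ex -Ey => -[]->.
  by apply/mem_pair; rewrite -Ex -Ey.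
move=> ->.
exists (setof [set v a]); split; first by apply/mem_pair; left.
exists (setof [set v a; v b]); split; first by apply/mem_pair; right.
split; [split|split; [split; [|split]|]].
- exact/mem_set1.
- by move=> z /mem_set1.
- by apply/mem_set2; left.
- by apply/mem_set2; right.
- by move=> z /mem_set2.
- by move=> z /mem_pair.
Qed.

(** * Transfer for encoded sets, relations and functions *)

(** The uniform level [k] is what makes [setof] collect the intended elements. *)
Lemma mem_image_ent (S Y : Type) (e : Y -> superstr S) (k : nat) :
  (forall y, level S k (e y)) -> injective e ->
  forall (A : set Y) y, mem (e y) (image_ent e A) <-> A y.
Proof.
move=> ek e_inj A y.
have Ak : e @` A `<=` level S k by move=> _ [z _ <-].
split=> [/(mem_setof _ Ak)[z Az /e_inj <-] //|Ay].
by apply/(mem_setof _ Ak); exists y.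
Qed.

Lemma mem_image_entE (S Y : Type) (e : Y -> superstr S) (k : nat) :
  (forall y, level S k (e y)) ->
  forall (A : set Y) x, mem x (image_ent e A) <-> (e @` A) x.
Proof. by move=> ek A x; apply: (@mem_setof _ k) => _ [z _ <-]. Qed.

Lemma mem_rel_ent (S Y Z : Type) (e : Y -> superstr S) (e' : Z -> superstr S)
    (k k' : nat) (r : Y -> Z -> Prop) p :
  (forall y, level S k (e y)) -> (forall z, level S k' (e' z)) ->
  mem p (rel_ent e e' r) <-> exists y z, r y z /\ p = pair (e y) (e' z).
Proof.
move=> ek ek'; apply: (@mem_setof _ (maxn k k').+2) => _ [y [z [_ ->]]].
apply: level_pair.
- exact: level_le (leq_maxl _ _) _ (ek y).
- exact: level_le (leq_maxr _ _) _ (ek' z).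
Qed.

Section Encodings.
Variables (K S : Type) (M : nsmodel K S) (Y Z : Type).
Variables (e : Y -> superstr S) (e' : Z -> superstr S) (k k' : nat).
Hypothesis ek : forall y, level S k (e y).
Hypothesis ek' : forall z, level S k' (e' z).
Hypothesis e_inj : injective e.
Hypothesis e'_inj : injective e'.

(** Each direction transfers one bounded sentence with [e' z] as a constant. Relations whose second
    argument is standard are thereby reduced to sets [*A]. *)
Lemma star_rel_section (r : Y -> Z -> Prop) (z : Z) a :
  mem (pair a (star M (e' z))) (star M (rel_ent e e' r)) <->
  mem a (star M (image_ent e [set y | r y z])).
Proof.
pose v n := if n == 0%N then rel_ent e e' r else
            if n == 1%N then image_ent e [set y | r y z] else
            if n == 2%N then e' z else
            if n == 3%N then image_ent e setT else image_ent e' setT.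
split=> h.
  (* Every element of the relation is a pair whose first coordinate lies in the section as soon as
     the second one is [z]. *)
  have H : holds v (BAll 5 0 (BEx 6 3 (BEx 7 4
             (BAnd (pair_bqf 5 6 7) (BImp (BEq 7 2) (BMem 6 1)))))).
    move=> _ /(mem_rel_ent _ _ ek ek')[y [w [ryw ->]]].
    exists (e y); split; first exact/(mem_image_ent ek e_inj).
    exists (e' w); split; first exact/(mem_image_ent ek' e'_inj).
    split; first exact/holds_pair.
    move=> /= /e'_inj wz; apply/(mem_image_ent ek e_inj).
    by rewrite /= -wz.
  have [a' [_ [b' [_ [/holds_pair Ep Eb]]]]] :=
    proj1 (transfer M _ v) H _ h.
  have /pair_inj[Ea Ez] : pair a (star M (e' z)) = pair a' b'.
    exact: Ep erefl erefl erefl.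
  by rewrite Ea; exact: Eb (esym Ez).
have H : holds v (BAll 6 1 (BEx 5 0 (pair_bqf 5 6 2))).
  move=> _ /(mem_image_entE ek)[y ryz <-].
  exists (pair (e y) (e' z)); split; last exact/holds_pair.
  by apply/(mem_rel_ent _ _ ek ek'); exists y, z.
have [p [pr /holds_pair Ep]] := proj1 (transfer M _ v) H _ h.
have <- : p = pair a (star M (e' z)) := Ep erefl erefl erefl.
exact: pr.
Qed.

(** The encodings are arbitrary so that [Y] may be a product encoded by ordered pairs, as
    subtraction demands. *)
Lemma star_app_preimage (f : Y -> Z) (A : set Z) a :
  mem a (star M (image_ent e setT)) ->
  mem (app (star M (graph_ent e e' f)) a) (star M (image_ent e' A)) <->
  mem a (star M (image_ent e (f @^-1` A))).
Proof.
move=> aY.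
pose v n := if n == 0%N then graph_ent e e' f else
            if n == 1%N then image_ent e (f @^-1` A) else
            if n == 2%N then image_ent e' A else
            if n == 3%N then image_ent e setT else image_ent e' setT.
(* Totality of the graph: [app] will not return its default value. *)
have H1 : holds v (BAll 6 3 (BEx 7 4 (BEx 5 0 (pair_bqf 5 6 7)))).
  move=> _ /(mem_image_entE ek)[y _ <-].
  exists (e' (f y)); split; first exact/(mem_image_ent ek' e'_inj).
  exists (pair (e y) (e' (f y))); split; last exact/holds_pair.
  by apply/(mem_rel_ent _ _ ek ek'); exists y, (f y).
(* The equivalence is stated for every pair of the graph, hence transfers to the pair selected by
   [app]. *)
have H2 : holds v (BAll 5 0 (BEx 6 3 (BEx 7 4 (BAnd (pair_bqf 5 6 7)
            (BAnd (BImp (BMem 7 2) (BMem 6 1))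
                  (BImp (BMem 6 1) (BMem 7 2))))))).
  move=> _ /(mem_rel_ent _ _ ek ek')[y [_ [-> ->]]].
  exists (e y); split; first exact/(mem_image_ent ek e_inj).
  exists (e' (f y)); split; first exact/(mem_image_ent ek' e'_inj).
  split; first exact/holds_pair.
  split=> /= [/(mem_image_ent ek' e'_inj)|
              /(mem_image_ent ek e_inj)] ?.
  - exact/(mem_image_ent ek e_inj).
  - exact/(mem_image_ent ek' e'_inj).
have [b [_ [p [pF /holds_pair Ep]]]] := proj1 (transfer M _ v) H1 _ aY.
have {Ep} Ep : p = pair a b := Ep erefl erefl erefl.
rewrite /update /= Ep in pF.
have [a' [_ [b' [_ [/holds_pair Ep' [h1 h2]]]]]] :=
  proj1 (transfer M _ v) H2 _ (app_mem pF).
have {Ep'} /pair_inj[-> ->] :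
    pair a (app (star M (graph_ent e e' f)) a) = pair a' b'.
  exact: Ep' erefl erefl erefl.
by split.
Qed.

End Encodings.

(** * The Boolean morphism A |-> *A and density *)

Section StarSet.
Variables (K S : Type) (M : nsmodel K S).
Variables (Y Z : topologicalType).
Variables (i : {inj [set: Y] >-> S}) (j : {inj [set: Z] >-> S}).

Lemma level_ient (y : Y) : level S 0 (ient i y).
Proof. by exists (i y). Qed.

Lemma star_set_std (A : set Y) y : star_set M i A (std_pt M i y) <-> A y.
Proof.
rewrite /star_set /= -extension.
apply: (iff_trans (star_mem M (ient i y) _)).
exact: mem_image_ent (@level_ient) (@ient_inj _ _ i) A y.
Qed.

Lemma star_setS (A B : set Y) : A `<=` B -> star_set M i A `<=` star_set M i B.
Proof. by move=> /setIidPl <-; rewrite star_setI => a []. Qed.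

(** Complements are relative to [Y], so a quantifier bounded by the entity of [Y] expresses them and
    transfer applies. *)
Lemma star_setC (A : set Y) : star_set M i (~` A) = ~` star_set M i A.
Proof.
pose v n := if n == 0%N then image_ent (ient i) (~` A) else
            if n == 1%N then image_ent (ient i) A else image_ent (ient i) setT.
have H : holds v (BAll 3 2 (BAnd (BImp (BMem 3 0) (BNot (BMem 3 1)))
                                 (BImp (BNot (BMem 3 1)) (BMem 3 0)))).
  move=> _ /mem_ient[y _ <-].
  have h := mem_image_ent (@level_ient) (@ient_inj _ _ i).
  by split=> [/h nAy /h|nAy] //; apply/h => Ay; apply/nAy/h.
have {}H := proj1 (transfer M _ v) H.
by apply/seteqP; split=> a; have [h1 h2] := H _ (svalP a); [exact: h1|exact: h2].
Qed.

Lemma star_set0 : star_set M i set0 = set0.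
Proof. by rewrite -setCT star_setC star_setT setCT. Qed.

(** The way back from [*Y] to [Y]: a nonstandard point of [*A] yields a standard one of [A].
    Estimates on nonstandard points and the density of [X] both rest on this. *)
Lemma star_set_neq0 (A : set Y) a : star_set M i A a -> A !=set0.
Proof.
by move=> Aa; apply/set0P/eqP => A0; move: Aa; rewrite A0 star_set0.
Qed.

Lemma star_fun_preimage (f : Y -> Z) (A : set Z) a :
  star_set M j A (star_fun M i j f a) <-> star_set M i (f @^-1` A) a.
Proof.
apply: (@star_app_preimage _ _ M _ _ _ _ 0 0) (svalP a).
- by move=> y; exists (i y).
- by move=> z; exists (j z).
- exact: ient_inj.
- exact: ient_inj.
Qed.

Lemma star_set_open (G : set Y) : open G -> open (star_set M i G).
Proof.
move=> oG; apply/nscompact_openE.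
by exists [set G] => [_ ->//|]; rewrite bigcup_set1.
Qed.

Lemma nbhs_star_set (a : nscompact M i) (W : set (nscompact M i)) :
  nbhs a W <-> exists G, [/\ open G, star_set M i G a & star_set M i G `<=` W].
Proof.
split=> [|[G [oG Ga GW]]].
  rewrite nbhsE => -[_ [/nscompact_openE[D oD <-] [G DG Ga]] DW].
  by exists G; split=> //; [exact: oD|move=> b Gb; apply: DW; exists G].
by rewrite nbhsE; exists (star_set M i G) => //; split=> //; exact: star_set_open.
Qed.

End StarSet.

Lemma star_fun_continuous (K S : Type) (M : nsmodel K S)
    (Y Z : topologicalType) (i : {inj [set: Y] >-> S}) (j : {inj [set: Z] >-> S})
    (f : Y -> Z) :
  continuous f ->
  continuous (star_fun M i j f : nscompact M i -> nscompact M j).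
Proof.
move=> f_cont a W /nbhs_star_set[G [oG Ga GW]].
apply/nbhs_star_set; exists (f @^-1` G); split.
- by move/continuousP: f_cont; apply.
- exact/(star_fun_preimage j).
- by move=> b /(star_fun_preimage j) /GW.
Qed.

(** * Standard parts *)

Section StandardPart.
Variables (K S : Type) (M : nsmodel K S) (R : realType).
Variable iR : {inj [set: R] >-> S}.
Implicit Types (xi : nscompact M iR) (x : R).

Lemma hyper_ltP (P : superstr (starS M)) (r : R) :
  hyper_lt iR P (sval (std_pt M iR r)) <->
  mem P (star M (image_ent (ient iR) [set y | y < r])).
Proof.
rewrite /hyper_lt /= -extension.
exact (@star_rel_section _ _ M _ _ _ _ _ _ (level_ient iR) (level_ient iR)
  (@ient_inj _ _ iR) (@ient_inj _ _ iR) (fun y z : R => y < z) r P).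
Qed.

Lemma hyper_absP (a : superstr (starS M)) (A : set R) :
  mem a (star M (image_ent (ient iR) setT)) ->
  mem (hyper_abs iR a) (star M (image_ent (ient iR) A)) <->
  mem a (star M (image_ent (ient iR) [set y | A `|y|])).
Proof.
exact (@star_app_preimage _ _ M _ _ _ _ _ _ (level_ient iR) (level_ient iR)
  (@ient_inj _ _ iR) (@ient_inj _ _ iR) (fun y : R => `|y|) A a).
Qed.

(** The preimage of [A] under subtraction is a set of encoded pairs; read as a relation, it is then
    cut by the section at the standard point [x]. *)
Lemma hyper_subP xi x (A : set R) :
  mem (hyper_sub iR (sval xi) (sval (std_pt M iR x)))
      (star M (image_ent (ient iR) A)) <->
  star_set M iR [set y | A (y - x)] xi.
Proof.
pose e (p : R * R) := pair (ient iR p.1) (ient iR p.2).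
have imageE (B : set (R * R)) :
    image_ent e B = rel_ent (ient iR) (ient iR) (fun y z => B (y, z)).
  congr setof; apply/seteqP; split=> [_ [[y z] Byz <-]|_ [y [z [Byz ->]]]].
    by exists y, z.
  by exists (y, z).
have sectionE (B : set (R * R)) :
    mem (pair (sval xi) (sval (std_pt M iR x))) (star M (image_ent e B)) <->
    star_set M iR [set y | B (y, x)] xi.
  rewrite imageE /= -extension.
  exact (@star_rel_section _ _ M _ _ _ _ _ _ (level_ient iR) (level_ient iR)
    (@ient_inj _ _ iR) (@ient_inj _ _ iR) (fun y z : R => B (y, z)) x (sval xi)).
have e2 p : level S 2 (e p) by apply: level_pair; exact: level_ient.
have e_inj : injective e.
  by move=> [y z] [y' z'] /pair_inj[/ient_inj /= -> /ient_inj /= ->].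
apply: iff_trans (sectionE [set p | A (p.1 - p.2)]).
apply (@star_app_preimage _ _ M _ _ _ _ _ _ e2 (level_ient iR) e_inj
  (@ient_inj _ _ iR) (fun p : R * R => p.1 - p.2) A).
(* The pair lies in the extension of the whole plane, whose section at [x] is all of [R]. *)
by apply/sectionE; apply: star_setS (svalP xi).
Qed.

Lemma approxP xi x :
  approx xi x <->
  forall n, (0 < n)%N -> star_set M iR [set y | `|y - x| < n%:R^-1] xi.
Proof.
have subT : mem (hyper_sub iR (sval xi) (sval (std_pt M iR x)))
                (star M (image_ent (ient iR) setT)).
  by apply/hyper_subP; apply: star_setS (svalP xi).
split=> H n n0.
  by have /hyper_ltP/(hyper_absP _ subT)/hyper_subP := H n n0.
by apply/hyper_ltP/(hyper_absP _ subT)/hyper_subP/H.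
Qed.

(** By the Archimedean property the radii 1/n may be replaced by all positive reals, so that radii
    can be halved below. *)
Lemma approx_ball xi x :
  approx xi x <-> forall eps, 0 < eps -> star_set M iR (ball x eps) xi.
Proof.
split=> [/approxP H eps eps0|H].
  have [n /andP[n0 ne]] : exists n, (0 < n)%N && (n%:R^-1 < eps).
    exists (Num.bound eps^-1).
    have eb : eps^-1 < (Num.bound eps^-1)%:R.
      by apply: archi_boundP; rewrite invr_ge0 ltW.
    have b0 : 0 < (Num.bound eps^-1)%:R :> R.
      by apply: lt_trans eb; rewrite invr_gt0.
    by rewrite -(ltr0n R) b0 invf_plt.
  apply: star_setS (H n n0) => y /= yx.
  by rewrite /ball /= distrC (lt_trans yx).
apply/approxP => n n0; apply: star_setS (H n%:R^-1 _) => [y|].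
  by rewrite /ball /= distrC.
by rewrite invr_gt0 ltr0n.
Qed.

Lemma finite_numberP xi :
  finite_number xi <-> exists n : nat, star_set M iR (ball 0 n%:R) xi.
Proof.
have E n : [set y : R | `|y| < n%:R] = ball 0 n%:R.
  by apply/seteqP; split=> y; rewrite /ball /= sub0r normrN.
split=> -[n h]; exists n; move: h.
  by move=> /hyper_ltP/(hyper_absP _ (svalP xi)); rewrite -E.
by rewrite -E => h; apply/hyper_ltP/(hyper_absP _ (svalP xi)).
Qed.

Lemma approx_inj xi x x' : approx xi x -> approx xi x' -> x = x'.
Proof.
move=> /approx_ball Hx /approx_ball Hx'; apply/eqP/negPn/negP => xx'.
have d0 : 0 < `|x - x'| / 2 by rewrite divr_gt0 ?normr_gt0 ?subr_eq0.
(* Both balls have half the distance as radius, so a standard point common to them contradicts the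
   triangle inequality. *)
have : star_set M iR (ball x (`|x - x'| / 2) `&` ball x' (`|x - x'| / 2)) xi.
  by rewrite star_setI; split; [exact: Hx|exact: Hx'].
move=> /star_set_neq0[y [xy x'y]].
have := ball_splitl xy x'y.
by rewrite /ball /= ltxx.
Qed.

Lemma finite_approx xi : finite_number xi -> exists x, approx xi x.
Proof.
move=> /finite_numberP[n nxi].
pose E := [set x : R | star_set M iR [set y | x < y] xi].
have ballE y : ball (0 : R) n%:R y -> - n%:R < y /\ y < n%:R.
  by rewrite /ball /= sub0r normrN ltr_norml => /andP[].
have E0 : E (- n%:R).
  by apply: star_setS nxi => y /ballE[].
have ubE : ubound E n%:R.
  move=> x Ex; have /star_set_neq0[y [/ballE[_ yn] /= xy]] :
      star_set M iR (ball 0 n%:R `&` [set y | x < y]) xi.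
    by rewrite star_setI.
  exact/ltW/(lt_trans xy).
have supE : has_sup E by split; [exists (- n%:R)|exists n%:R].
exists (sup E); apply/approx_ball => eps eps0.
have [x Ex xs] := sup_adherent eps0 supE.
have e20 : 0 < eps / 2 by rewrite divr_gt0.
have nE : ~ E (sup E + eps / 2).
  by move=> /(sup_upper_bound supE); lra.
(* The two facts locate [xi] in the extension of the interval from [x], which exceeds [sup E - eps],
   to [sup E + eps / 2]. *)
have : star_set M iR ([set y | x < y] `&` ~` [set y | sup E + eps / 2 < y]) xi.
  by rewrite star_setI star_setC.
apply: star_setS => y /= [xy /negP]; rewrite -leNgt => ys.
by rewrite /ball /= ltr_norml; apply/andP; split; lra.
Qed.

(** [st] is an arbitrary choice by [get]; uniqueness identifies it. *)
Lemma approx_st xi x : approx xi x -> st xi = x.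
Proof. by move=> Hx; apply: approx_inj (getI Hx) Hx. Qed.

Lemma finite_st xi : finite_number xi -> approx xi (st xi).
Proof. by move=> /finite_approx[x Hx]; rewrite (approx_st Hx). Qed.

Lemma approx_finite xi x : approx xi x -> finite_number xi.
Proof.
move=> /approx_ball Hx; apply/finite_numberP; exists (Num.bound (`|x| + 1)).
apply: star_setS (Hx 1 ltr01) => y; rewrite /ball /= sub0r normrN => xy.
apply: lt_trans (archi_boundP _); last by rewrite addr_ge0.
by rewrite -ltrBlDl (le_lt_trans _ xy) // distrC lerB_dist.
Qed.

End StandardPart.

(** * Continuity, extension and uniqueness of the standard part of [*f] *)

Section StandardPartMap.
Variables (K S : Type) (M : nsmodel K S) (X : topologicalType) (R : realType).
Variables (iX : {inj [set: X] >-> S}) (iR : {inj [set: R] >-> S}).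
Variables (f : X -> R) (f_cont : continuous f).

Lemma star_fun_std_approx x : approx (star_fun M iX iR f (std_pt M iX x)) (f x).
Proof.
apply/approx_ball => eps eps0.
exact/(star_fun_preimage iR)/star_set_std/ballxx.
Qed.

Lemma finite_dom_std x : finite_dom M iX iR f (std_pt M iX x).
Proof. exact: approx_finite (star_fun_std_approx x). Qed.

Lemma st_fun_std x : st_fun M iX iR f (std_pt M iX x) = f x.
Proof. exact: approx_st (star_fun_std_approx x). Qed.

Lemma st_fun_continuous :
  {within finite_dom M iX iR f, continuous (st_fun M iX iR f)}.
Proof.
apply/subspace_continuousP => a fa; apply/cvgrPdist_lt => eps eps0.
have e20 : 0 < eps / 2 by rewrite divr_gt0.
have /approx_ball/(_ _ e20)/(star_fun_preimage iR) aG := finite_st fa.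
apply/nbhs_star_set.
exists (f @^-1` ball (st_fun M iX iR f a) (eps / 2)); split=> //.
  by move/continuousP: f_cont; apply; exact: ball_open.
move=> b /(star_fun_preimage iR) bG fb.
have /approx_ball/(_ _ e20) bst := finite_st fb.
(* The point [*f(b)] lies in the extensions of both balls, so these share a real [y], which links
   the two standard parts. *)
have /star_set_neq0[y [ay /ball_sym yb]] : star_set M iR
    (ball (st_fun M iX iR f a) (eps / 2) `&` ball (st_fun M iX iR f b) (eps / 2))
    (star_fun M iX iR f b) by rewrite star_setI.
by have := ball_split ay yb.
Qed.

(** If [g a] and [h a] differed, a basic neighbourhood [*G] of [a] would keep both maps within half
    their distance on [D]; but [*G] contains a standard point, where the maps agree. *)
Lemma within_continuous_unique (D : set (nscompact M iX))
    (g h : nscompact M iX -> R) :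
  (forall x, D (std_pt M iX x)) ->
  {within D, continuous g} -> {within D, continuous h} ->
  (forall x, g (std_pt M iX x) = h (std_pt M iX x)) ->
  forall a, D a -> g a = h a.
Proof.
move=> Dstd /subspace_continuousP gc /subspace_continuousP hc gh a Da.
apply/eqP/negPn/negP => neq.
have d0 : 0 < `|g a - h a| / 2 by rewrite divr_gt0 ?normr_gt0 ?subr_eq0.
have near_close (k : nscompact M iX -> R) : k @ within D (nbhs a) --> k a ->
    nbhs a [set t | D t -> `|k a - k t| < `|g a - h a| / 2].
  by move/cvgrPdist_lt => /(_ _ d0).
have [G [_ /star_set_neq0[x Gx] GW]] := proj1 (nbhs_star_set _ _)
  (filterI (near_close g (gc a Da)) (near_close h (hc a Da))).
have /GW[/(_ (Dstd x)) gx /(_ (Dstd x))] :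
  star_set M iX G (std_pt M iX x) by apply/star_set_std.
rewrite -gh => hx.
have := @ball_splitl _ _ (g (std_pt M iX x)) (g a) (h a) _ gx hx.
by rewrite /ball /= ltxx.
Qed.

End StandardPartMap.

Theorem mainTheorem2 (R : realType) (X : topologicalType) (S : Type)
    (iX : {inj [set: X] >-> S}) (iR : {inj [set: R] >-> S})
    (K : Type) (M : nsmodel K S)
    (K_infinite : infinite_set [set: K])
    (K_gt_T : card_lt [set G : set X | open G] [set: K])
    (K_gt_tau : card_lt [set G : set R | open G] [set: K])
    (f : X -> R) (f_cont : continuous f) :
  [/\ continuous (star_fun M iX iR f : nscompact M iX -> nscompact M iR),
      {within finite_dom M iX iR f, continuous (st_fun M iX iR f)},
      (forall x : X, finite_dom M iX iR f (std_pt M iX x)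
                     /\ st_fun M iX iR f (std_pt M iX x) = f x)
    & forall g : nscompact M iX -> R,
        {within finite_dom M iX iR f, continuous g} ->
        (forall x : X, g (std_pt M iX x) = f x) ->
        forall a, finite_dom M iX iR f a -> g a = st_fun M iX iR f a].
Proof.
split.
- exact: star_fun_continuous.
- exact: st_fun_continuous.
- by move=> x; split; [exact: finite_dom_std|exact: st_fun_std].
- move=> g g_cont gf a; apply: within_continuous_unique => //.
  + exact: finite_dom_std.
  + exact: st_fun_continuous.
  + by move=> x; rewrite gf st_fun_std.
Qed.
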